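(* Let $(A,\mu,\alpha,D)$ be an object of $\mathbf{HomAsDer}_\alpha$, write $ab:=\mu(a,b)$, and define the bilinear map $[\cdot,\cdot]_A:A\times A\to A$ by $[a,b]_A:=ab-ba$ for all $a,b\in A$. Then the quadruple $(A,[\cdot,\cdot]_A,\alpha,D)$ is an object of $\mathbf{HomLieDer}_\alpha$.
   Context: All vector spaces are over a fixed field $\mathbb{K}$ of characteristic $0$. A Hom-Lie algebra is a triple $(\mathfrak g,[\cdot,\cdot],\alpha)$ with $\mathfrak g$ a vector space, $[\cdot,\cdot]:\mathfrak g\times\mathfrak g\to\mathfrak g$ a skew-symmetric bilinear map and $\alpha:\mathfrak g\to\mathfrak g$ a linear map such that $[\alpha(x),[y,z]]+[\alpha(y),[z,x]]+[\alpha(z),[x,y]]=0$ and $\alpha([x,y])=[\alpha(x),\alpha(y)]$ for all $x,y,z\in\mathfrak g$. An $\alpha$-derivation of it is a linear map $d:\mathfrak g\to\mathfrak g$ with $d\circ\alpha=\alpha\circ d$ and $d([x,y])=[d(x),\alpha(y)]+[\alpha(x),d(y)]$ for all $x,y$. A Hom-associative algebra (not assumed unital) is a triple $(A,\mu,\alpha)$ with $A$ a vector space, $\mu:A\times A\to A$ bilinear, written $\mu(a,b)=ab$, and $\alpha:A\to A$ linear such that $\alpha(ab)=\alpha(a)\alpha(b)$ and $\alpha(a)(bc)=(ab)\alpha(c)$ for all $a,b,c\in A$. An $\alpha$-derivation of it is a linear map $D:A\to A$ with $D\circ\alpha=\alpha\circ D$ and $D(ab)=D(a)\alpha(b)+\alpha(a)D(b)$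 for all $a,b$. $\mathbf{HomLieDer}_\alpha$ is the category whose objects are Hom-Lie algebras with an $\alpha$-derivation $(\mathfrak g,[\cdot,\cdot],\alpha,d)$, and $\mathbf{HomAsDer}_\alpha$ the category whose objects are Hom-associative algebras with an $\alpha$-derivation $(A,\mu,\alpha,D)$ (the twisting map $\alpha$ varies with the object); morphisms in both are linear maps preserving the bracket (resp. product) and commuting with the twisting maps and the chosen derivations. *)

(* Defs.v *)
From mathcomp Require Import all_boot all_order all_algebra.

Set Implicit Arguments.
Unset Strict Implicit.
Unset Printing Implicit Defensive.

Import GRing.Theory.
Local Open Scope ring_scope.

Section HomAlgebras.
Variables (K : fieldType) (V : lmodType K).

Definition is_linear (f : V -> V) : Prop := GRing.linear_for *:%R f.

Definition is_bilinear (op : V -> V -> V) : Prop := bilinear_for *:%R *:%R op.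

Record is_hom_lie (br : V -> V -> V) (alpha : V -> V) : Prop := IsHomLie {
  hom_lie_bilinear : is_bilinear br;
  hom_lie_skew : forall x y, br x y = - br y x;
  hom_lie_linear : is_linear alpha;
  hom_lie_jacobi : forall x y z,
    br (alpha x) (br y z) + br (alpha y) (br z x) + br (alpha z) (br x y) = 0;
  hom_lie_mult : forall x y, alpha (br x y) = br (alpha x) (alpha y)
}.

Record is_hom_assoc (mu : V -> V -> V) (alpha : V -> V) : Prop := IsHomAssoc {
  hom_assoc_bilinear : is_bilinear mu;
  hom_assoc_linear : is_linear alpha;
  hom_assoc_mult : forall a b, alpha (mu a b) = mu (alpha a) (alpha b);
  hom_assoc_assoc : forall a b c, mu (alpha a) (mu b c) = mu (mu a b) (alpha c)
}.

(* The operation [op] is either the bracket of a Hom-Lie algebra or the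
   product of a Hom-associative algebra: the two notions of alpha-derivation
   are given by the same formulas. *)
Record is_alpha_derivation (op : V -> V -> V) (alpha d : V -> V) : Prop :=
  IsAlphaDerivation {
  alpha_der_linear : is_linear d;
  alpha_der_comm : forall x, d (alpha x) = alpha (d x);
  alpha_der_leibniz : forall x y,
    d (op x y) = op (d x) (alpha y) + op (alpha x) (d y)
}.

(* (V, br, alpha, d) is an object of HomLieDer_alpha. *)
Record is_HomLieDer (br : V -> V -> V) (alpha d : V -> V) : Prop :=
  IsHomLieDer {
  HomLieDer_hom_lie : is_hom_lie br alpha;
  HomLieDer_derivation : is_alpha_derivation br alpha d
}.

(* (V, mu, alpha, D) is an object of HomAsDer_alpha. *)
Record is_HomAsDer (mu : V -> V -> V) (alpha D : V -> V) : Prop :=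
  IsHomAsDer {
  HomAsDer_hom_assoc : is_hom_assoc mu alpha;
  HomAsDer_derivation : is_alpha_derivation mu alpha D
}.

Definition commutator (mu : V -> V -> V) (a b : V) : V := mu a b - mu b a.

End HomAlgebras.

(* Main.v *)
Require Import Defs.
From mathcomp Require Import all_boot all_order all_algebra.

Import GRing.Theory.
Local Open Scope ring_scope.

(** The only substantial point is the Hom-Jacobi identity, [commutator_hom_jacobi]: the cyclic sum
    expands into twelve signed triple products, and Hom-associativity makes them cancel in pairs.
    The other axioms pass from [mu] to its commutator by subtracting an identity from the same
    identity with its two arguments exchanged, as in [commutator_derivation]. *)

Section Commutator.
Variables (K : fieldType) (V : lmodType K).
Implicit Types (f d alpha : V -> V) (mu : V -> V -> V).

(** Linearity is an unbundled predicate on c *: x + y, so a difference is read as the case c =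
    -1. *)
Lemma is_linearB f : is_linear f -> {morph f : x y / x - y}.
Proof. by move=> flin x y; rewrite addrC -scaleN1r flin scaleN1r addrC. Qed.

Lemma bilinearBl mu z : is_bilinear mu -> {morph mu^~ z : x y / x - y}.
Proof. by case=> mul_l _; apply: is_linearB (mul_l z). Qed.

Lemma bilinearBr mu z : is_bilinear mu -> {morph mu z : x y / x - y}.
Proof. by case=> _ mul_r; apply: is_linearB (mul_r z). Qed.

Lemma commutator_bilinear mu :
  is_bilinear mu -> is_bilinear (commutator mu).
Proof.
case=> mul_l mul_r.
(* Restated with [mu] applied to both arguments, so that [rewrite] can match them. *)
have mulPl c x y z : mu (c *: x + y) z = c *: mu x z + mu y z by exact: mul_l.
have mulPr c x y z : mu z (c *: x + y) = c *: mu z x + mu z y by exact: mul_r.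
by split=> z c x y; rewrite /= /commutator mulPl mulPr opprD addrACA scalerBr.
Qed.

Lemma commutatorC mu x y : commutator mu x y = - commutator mu y x.
Proof. by rewrite /commutator opprB. Qed.

Lemma commutator_hom_jacobi mu alpha x y z : is_hom_assoc mu alpha ->
  commutator mu (alpha x) (commutator mu y z)
  + commutator mu (alpha y) (commutator mu z x)
  + commutator mu (alpha z) (commutator mu x y) = 0.
Proof.
case=> mu_bil _ _ mulA; rewrite /commutator.
(* Reversed Hom-associativity brings every triple product to the shape [mu (alpha a) (mu b c)]. *)
rewrite !(bilinearBl _ _ mu_bil) !(bilinearBr _ _ mu_bil) -!mulA !opprB !addrA.
(* Hom-associativity leaves each ordering of x, y, z once with each sign. *)
rewrite [LHS](ACl ((1*12)*(2*7)*(4*5)*(3*10)*(6*11)*(8*9)))%AC /=.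
by rewrite ?subrr ?addNr ?addr0.
Qed.

Lemma commutator_hom_lie mu alpha :
  is_hom_assoc mu alpha -> is_hom_lie (commutator mu) alpha.
Proof.
move=> muA; have [mu_bil alpha_lin alphaM _] := muA.
split=> // [|x y|x y z|x y].
- exact: commutator_bilinear.
- exact: commutatorC.
- exact: commutator_hom_jacobi.
- by rewrite /commutator is_linearB // !alphaM.
Qed.

Lemma commutator_derivation mu alpha d :
  is_alpha_derivation mu alpha d ->
  is_alpha_derivation (commutator mu) alpha d.
Proof.
case=> d_lin d_comm d_leibniz; split=> // x y.
(* Swapping the two terms of the subtracted Leibniz expansion pairs the terms in [d x], and those in
   [d y], into commutators. *)
by rewrite /commutator is_linearB // !d_leibniz [X in _ - X]addrC opprD addrACA.
Qed.

End Commutator.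

Theorem proposition2p19 (K : fieldType) (charK0 : [pchar K]%R =i pred0)
    (A : lmodType K) (mu : A -> A -> A) (alpha D : A -> A) :
  is_HomAsDer mu alpha D -> is_HomLieDer (commutator mu) alpha D.
Proof.
case=> muA muD; split; first exact: commutator_hom_lie.
exact: commutator_derivation.
Qed.
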